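(* Let $M$ be an $n\times n$ positive semidefinite matrix of rank $d$, write $M=V^TV$ with $V\in\mathbb{R}^{d\times n}$ having columns $v_1,\dots,v_n$, and let $1\le j\le d$. Let $\alpha\ge 0$ and let $c=(c_1,\dots,c_n)$ be an $\alpha$-optimal solution of \[ \text{maximize } \Gamma_j\Big(\sum_{i=1}^n c_iv_iv_i^T\Big)\ \text{ s.t. } \sum_{i=1}^n c_i=j,\ c_i\ge 0\ \forall i. \] Let $S$ be a random multiset of $j$ elements of $[n]$, each sampled independently with replacement with $\Pr[\text{element}=\ell]=c_\ell/j$. Then \[ \mathbb{E}\,\det(M_{S,S})\ \ge\ \frac{j!}{j^j}\,e^{-\alpha}\,\mathrm{msd}_j(M), \] and $\frac{j!}{j^j}\sim\sqrt{2\pi j}\,e^{-j}$.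
   Context: For a multiset $S$ of indices, $M_{S,S}$ is the submatrix with rows and columns indexed by $S$, repeated according to multiplicity. $\mathrm{msd}_j(M)\coloneqq\max\{\det(M_{T,T}): T\subseteq[n],\ |T|=j\}$. For $x\in\mathbb{R}^d_+$ with $x_{(i)}$ its $i$-th largest coordinate, let $k$ be the unique integer with $0\le k\le j-1$ such that $x_{(k)}>\frac{1}{j-k}\sum_{i>k}x_{(i)}\ge x_{(k+1)}$ (with $x_{(0)}=\infty$), and $\gamma_j(x)\coloneqq\sum_{i=1}^k\ln x_{(i)}+(j-k)\ln\big(\frac{1}{j-k}\sum_{i=k+1}^d x_{(i)}\big)$ (with $\ln 0=-\infty$); for $X\succeq 0$ with eigenvalue vector $\lambda$, $\Gamma_j(X)\coloneqq\gamma_j(\lambda)$. A feasible $c$ is $\alpha$-optimal if its objective value is at least the optimal value minus $\alpha$. *)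

(* Defs.v *)
From HB Require Import structures.
From Stdlib Require Import Reals Lra.
From Stdlib Require Import Classical ClassicalEpsilon FunctionalExtensionality.
From mathcomp Require Import all_boot all_order all_algebra.

Set Implicit Arguments.
Unset Strict Implicit.
Unset Printing Implicit Defensive.

Definition R_eqb (x y : R) : bool := if Req_EM_T x y then true else false.

Lemma R_eqP : Equality.axiom R_eqb.
Proof. move=> x y; rewrite /R_eqb; case: Req_EM_T => h; constructor => //. Qed.

HB.instance Definition _ := hasDecEq.Build R R_eqP.

Definition R_find (P : pred R) (n : nat) : option R :=
  match excluded_middle_informative (exists x, P x) with
  | left H => Some (proj1_sig (constructive_indefinite_description _ H))
  | right _ => None
  end.

Lemma R_find_correct P n x : R_find P n = Some x -> P x.
Proof.
rewrite /R_find; case: excluded_middle_informative => // H [<-].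
exact: (proj2_sig (constructive_indefinite_description _ H)).
Qed.

Lemma R_find_complete (P : pred R) : (exists x, P x) -> exists n, R_find P n.
Proof. by move=> H; exists 0%N; rewrite /R_find; case: excluded_middle_informative. Qed.

Lemma R_find_ext (P Q : pred R) : P =1 Q -> R_find P =1 R_find Q.
Proof. by move=> /functional_extensionality ->. Qed.

HB.instance Definition _ :=
  hasChoice.Build R R_find_correct R_find_complete R_find_ext.

Lemma R_addA : associative Rplus. Proof. by move=> *; rewrite Rplus_assoc. Qed.
Lemma R_addC : commutative Rplus. Proof. by move=> *; rewrite Rplus_comm. Qed.
Lemma R_add0 : left_id R0 Rplus. Proof. by move=> *; rewrite Rplus_0_l. Qed.
Lemma R_addN : left_inverse R0 Ropp Rplus. Proof. by move=> *; rewrite Rplus_opp_l. Qed.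

HB.instance Definition _ := @GRing.isZmodule.Build R R0 Ropp Rplus R_addA R_addC R_add0 R_addN.

Lemma R_mulA : associative Rmult. Proof. by move=> *; rewrite Rmult_assoc. Qed.
Lemma R_mulC : commutative Rmult. Proof. by move=> *; rewrite Rmult_comm. Qed.
Lemma R_mul1 : left_id R1 Rmult. Proof. by move=> *; rewrite Rmult_1_l. Qed.
Lemma R_mulDl : left_distributive Rmult Rplus.
Proof. by move=> *; rewrite Rmult_plus_distr_r. Qed.
Lemma R_one_neq0 : R1 != R0.
Proof. by apply/eqP; exact: R1_neq_R0. Qed.

HB.instance Definition _ :=
  @GRing.Zmodule_isComNzRing.Build R R1 Rmult R_mulA R_mulC R_mul1 R_mulDl R_one_neq0.

Definition R_inv (x : R) : R := if R_eqb x R0 then R0 else Rinv x.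

Lemma R_mulVf (x : R) : x != R0 -> Rmult (R_inv x) x = R1.
Proof.
move=> hx; rewrite /R_inv.
have -> : R_eqb x R0 = false by exact: (negbTE hx).
apply: Rinv_l => hx0; move/eqP: hx; apply; exact: hx0.
Qed.

Lemma R_inv0 : R_inv R0 = R0.
Proof. by rewrite /R_inv /R_eqb; case: Req_EM_T. Qed.

HB.instance Definition _ := @GRing.ComNzRing_isField.Build R R_inv R_mulVf R_inv0.

Definition Rltb (x y : R) : bool := if Rlt_dec x y then true else false.
Definition Rleb (x y : R) : bool := if Rle_dec x y then true else false.

(* ---------- extended reals [-oo, +oo) as option R (None = -oo) ---------- *)
Definition ext_le (a b : option R) : Prop :=
  match a, b with
  | None, _ => True
  | Some _, None => False
  | Some x, Some y => Rle x y
  end.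
Definition ext_add (a b : option R) : option R :=
  match a, b with Some x, Some y => Some (Rplus x y) | _, _ => None end.
Definition ext_sub_real (a : option R) (al : R) : option R :=
  match a with Some x => Some (Rminus x al) | None => None end.
(* ln with the convention ln 0 = -oo (only nonnegative arguments arise) *)
Definition ln_ext (a : R) : option R :=
  if Rltb 0 a then Some (ln a) else None.

Local Open Scope ring_scope.

(* x_(1) >= x_(2) >= ... : sort decreasingly; x_(i) = nth 0 (xs) (i-1). *)
Definition sort_desc (x : seq R) : seq R := sort (fun a b => Rleb b a) x.

Definition tail_sum (y : seq R) (k : nat) : R := foldr Rplus R0 (drop k y).

(* the defining condition of k:
   x_(k) > (1/(j-k)) sum_{i>k} x_(i) >= x_(k+1), with x_(0) = +oo *)
Definition gamma_cond (j : nat) (y : seq R) (k : nat) : bool :=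
  let avg := Rdiv (tail_sum y k) (INR (j - k)) in
  (if k is k'.+1 then Rltb avg (nth R0 y k') else true)
  && Rleb (nth R0 y k) avg.

(* k = the (unique, by the paper) integer in [0, j-1] satisfying gamma_cond *)
Definition gamma_k (j : nat) (y : seq R) : nat := find (gamma_cond j y) (iota 0 j).

Fixpoint ext_sum (s : seq (option R)) : option R :=
  match s with [::] => Some R0 | a :: s' => ext_add a (ext_sum s') end.

Definition gamma (j : nat) (x : seq R) : option R :=
  let y := sort_desc x in
  let k := gamma_k j y in
  ext_add (ext_sum (map ln_ext (take k y)))
          (ext_sum (nseq (j - k) (ln_ext (Rdiv (tail_sum y k) (INR (j - k)))))).

Definition is_eigenvalue_list (d : nat) (X : 'M[R]_d) (s : seq R) : Prop :=
  char_poly X = \prod_(a <- s) ('X - a%:P).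

Definition eigenvalues (d : nat) (X : 'M[R]_d) : seq R :=
  epsilon (inhabits [::]) (is_eigenvalue_list X).

Definition Gamma (j d : nat) (X : 'M[R]_d) : option R := gamma j (eigenvalues X).

Definition psd (n : nat) (M : 'M[R]_n) : Prop :=
  M^T = M /\ forall x : 'cV[R]_n, Rle R0 ((x^T *m M *m x) ord0 ord0).

(* msd_j(M) = max over T subset [n], |T| = j, of det(M_{T,T});
   subsets of size j are represented by injective maps 'I_j -> 'I_n
   (the principal minor does not depend on the ordering). *)
Definition msd (j n : nat) (M : 'M[R]_n) : R :=
  \big[Rmax/R0]_(s : {ffun 'I_j -> 'I_n} | injectiveb s) \det (mxsub s s M).

Definition Xmat (d n : nat) (V : 'M[R]_(d, n)) (c : 'I_n -> R) : 'M[R]_d :=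
  \sum_(i < n) c i *: (col i V *m (col i V)^T).

Definition feasible (j n : nat) (c : 'I_n -> R) : Prop :=
  \sum_(i < n) c i = INR j /\ forall i, Rle R0 (c i).

Definition alpha_optimal (j d n : nat) (V : 'M[R]_(d, n)) (al : R) (c : 'I_n -> R) : Prop :=
  feasible j c /\
  forall c' : 'I_n -> R, feasible j c' ->
    ext_le (ext_sub_real (Gamma j (Xmat V c')) al) (Gamma j (Xmat V c)).

(* E det(M_{S,S}) for S = j i.i.d. draws with Pr[l] = c_l / j;
   a draw is a map 'I_j -> 'I_n, M_{S,S} repeats rows/cols by multiplicity. *)
Definition expected_det (j n : nat) (M : 'M[R]_n) (c : 'I_n -> R) : R :=
  \sum_(s : {ffun 'I_j -> 'I_n})
     (\prod_(t < j) Rdiv (c (s t)) (INR j)) * \det (mxsub s s M).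

(* Main.v *)
Require Import Defs.
From HB Require Import structures.
From Stdlib Require Import Reals Lra FunctionalExtensionality ClassicalEpsilon.
From mathcomp Require Import all_boot all_order all_fingroup all_algebra.
From Coquelicot Require Coquelicot.

(** Let e_j denote the j-th elementary symmetric polynomial and X the matrix
    sum_i c_i v_i v_i^T.  The sum of det(A_{s,s}) over all maps s from [j] to
    [n] is invariant under AB |-> BA, so evaluating it at diag(c) V^T V and at
    X gives E det(M_{S,S}) = j!/j^j e_j(lambda(X)).  Moreover
    e_j >= exp gamma_j on nonnegative vectors, with the reverse inequality
    when at most j entries are nonzero.  The point c = 1_T has objective value
    at least ln det(M_{T,T}), so alpha-optimality yields
    e_j(lambda(X)) >= e^(-alpha) det(M_{T,T}).  Stirling's formula follows
    from the convergence of ln(n!) - (n + 1/2) ln n + n and the Wallis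
    integrals. *)

Set Implicit Arguments.
Unset Strict Implicit.
Unset Printing Implicit Defensive.

(** * Stirling's formula *)

Section Stirling.
Import Coquelicot.Coquelicot.
Local Open Scope R_scope.

Definition wallis (n : nat) : R := RInt (fun x => sin x ^ n) 0 (PI / 2).

Lemma ex_RInt_sin_pow n a b : ex_RInt (fun x => sin x ^ n) a b.
Proof.
apply: ex_RInt_continuous => x _; apply: ex_derive_continuous; auto_derive; auto.
Qed.

Lemma wallis0 : wallis 0 = PI / 2.
Proof. by rewrite /wallis RInt_const /scal /= /mult /=; lra. Qed.

Lemma wallis1 : wallis 1 = 1.
Proof.
rewrite /wallis; apply: is_RInt_unique.
have -> : 1 = minus (- cos (PI / 2)) (- cos 0).
  by rewrite cos_PI2 cos_0 /minus /plus /opp /=; lra.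
apply: (is_RInt_derive (fun x => - cos x)) => x _.
  by auto_derive => //; lra.
by apply: ex_derive_continuous; auto_derive.
Qed.

(** Integration by parts: the combination [h] integrates is the derivative of
    [- cos x * sin x ^ n.+1], which vanishes at both endpoints. *)
Lemma wallisSS n : INR n.+2 * wallis n.+2 = INR n.+1 * wallis n.
Proof.
have h : is_RInt (fun x => INR n.+2 * sin x ^ n.+2 - INR n.+1 * sin x ^ n)
   0 (PI / 2) 0.
  have {2}-> : 0 = minus (- cos (PI / 2) * sin (PI / 2) ^ n.+1)
                         (- cos 0 * sin 0 ^ n.+1).
    by rewrite cos_PI2 sin_0 /minus /plus /opp /= ; lra.
  apply: (is_RInt_derive (fun x => - cos x * sin x ^ n.+1)) => x _.
    auto_derive => //; have := sin2_cos2 x; rewrite /Rsqr => h.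
    have -> : INR n.+2 = INR n.+1 + 1 by rewrite S_INR.
    rewrite -[match n with O => 1 | S _ => INR n + 1 end]/(INR n.+1).
    have e : cos x * cos x = 1 - sin x * sin x by lra.
    rewrite -!tech_pow_Rmult.
    transitivity (sin x * (sin x * sin x ^ n) -
      INR n.+1 * (cos x * cos x) * sin x ^ n); first by ring.
    by rewrite e; ring.
  by apply: ex_derive_continuous; auto_derive.
have := is_RInt_unique _ _ _ _ h.
rewrite RInt_minus; last first.
- by apply: ex_RInt_scal; exact: ex_RInt_sin_pow.
- by apply: ex_RInt_scal; exact: ex_RInt_sin_pow.
rewrite !RInt_scal; try exact: ex_RInt_sin_pow.
rewrite -/(wallis n) -/(wallis n.+2) /minus /plus /opp /scal /= /mult /=; lra.
Qed.

Lemma wallis_decr n : wallis n.+1 <= wallis n.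
Proof.
have := PI_RGT_0 => pi0.
apply: RInt_le; [lra | exact: ex_RInt_sin_pow | exact: ex_RInt_sin_pow |].
move=> x [x0 x1] /=.
have s0 : 0 <= sin x by apply: sin_ge_0; lra.
have := pow_le _ n s0; have [_ s1] := SIN_bound x; nra.
Qed.

(** The recurrence [wallisSS] makes this product independent of n, so its value at n = 0 decides. *)
Lemma wallis_mulS n : INR n.+1 * (wallis n.+1 * wallis n) = PI / 2.
Proof.
elim: n => [|n IH]; first by rewrite wallis1 wallis0 /=; lra.
by rewrite -Rmult_assoc wallisSS Rmult_assoc [wallis n * _]Rmult_comm.
Qed.

Lemma wallis_gt0 n : 0 < wallis n.
Proof.
have pi0 := PI_RGT_0; elim: n => [|n IH]; first by rewrite wallis0; lra.
have := wallis_mulS n; have : 0 < INR n.+1 by apply: lt_0_INR; apply/ltP.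
move=> n0 e; have h : 0 < INR n.+1 * wallis n by exact: Rmult_lt_0_compat.
apply: (Rmult_lt_reg_l _ _ _ h); lra.
Qed.

Lemma INR_factS n : INR (n.+1)`! = INR n.+1 * INR n`!.
Proof. by rewrite factS -mult_INR multE. Qed.

Lemma INR_fact_gt0 n : 0 < INR n`!.
Proof. by apply: lt_0_INR; apply/ltP; exact: fact_gt0. Qed.

(** The even Wallis integrals through the central binomial coefficient, cleared of denominators for
    the induction. *)
Lemma wallis_even n :
  wallis (n.*2) * (4 ^ n * (INR n`! * INR n`!)) = INR (n.*2)`! * (PI / 2).
Proof.
elim: n => [|n IH]; first by rewrite wallis0 /=; lra.
rewrite doubleS !INR_factS; have w := wallisSS n.*2.
have e1 : INR n.*2 = 2 * INR n by rewrite -muln2 -multE mult_INR /=; lra.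
have e2 : INR n.*2.+1 = 2 * INR n + 1 by rewrite S_INR e1.
have e3 : INR n.*2.+2 = 2 * INR n + 2 by rewrite !S_INR e1; lra.
rewrite e2 e3 in w *; have e4 := S_INR n; rewrite e4 -tech_pow_Rmult.
transitivity ((2 * INR n + 2) * wallis n.*2.+2 *
   (4 ^ n * (INR n`! * INR n`!)) * (2 * INR n + 2)); first by ring.
rewrite w.
transitivity ((2 * INR n + 1) * (2 * INR n + 2) *
  (wallis n.*2 * (4 ^ n * (INR n`! * INR n`!)))); first by ring.
by rewrite IH; ring.
Qed.

(** Monotonicity traps the square between the products of [wallis n] with its two neighbours, which
    [wallis_mulS] evaluates. *)
Lemma wallis_sqr_bounds n : (0 < n)%N ->
  PI / 2 / INR n.+1 <= wallis n * wallis n <= PI / 2 / INR n.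
Proof.
case: n => // n _; have wn := wallis_gt0 n.+1.
have divE k : PI / 2 / INR k.+1 = wallis k.+1 * wallis k.
  rewrite -(wallis_mulS k); field; exact: not_0_INR.
rewrite !divE; split.
  by apply: Rmult_le_compat_r; [lra | exact: wallis_decr].
by apply: Rmult_le_compat_l; [lra | exact: wallis_decr].
Qed.

(** For n > 0, the logarithm of n! / (n^(n + 1/2) e^(-n)), whose limit is to be identified as ln
    (sqrt (2 PI)). *)
Definition stirling_log (n : nat) : R :=
  ln (INR n`!) - (INR n + / 2) * ln (INR n) + INR n.

(** The difference vanishes at 0 and has a nonnegative derivative. At t = 1/n the bound reads 1 / (n
    + 1/2) <= ln (1 + 1/n), so [stirling_log] decreases. *)
Lemma ln1p_ge t : 0 <= t -> 2 * t / (2 + t) <= ln (1 + t).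
Proof.
move=> t0; pose f x := ln (1 + x) - 2 * x / (2 + x).
pose df x := / (1 + x) - 4 / ((2 + x) * (2 + x)).
have [||c [hc e]] := MVT_gen f 0 t df; rewrite ?Rmin_left ?Rmax_right //.
- move=> x [x0 _]; rewrite /f /df; auto_derive; [lra | field; lra].
- move=> x [x0 _]; apply/continuity_pt_filterlim.
  apply: ex_derive_continuous; rewrite /f; auto_derive; lra.
rewrite Rmin_left // Rmax_right // in hc.
have : 0 <= df c.
  have -> : df c = c * c / ((1 + c) * ((2 + c) * (2 + c))).
    by rewrite /df; field; lra.
  by apply: Rdiv_le_0_compat; nra.
have : f 0 = 0 by rewrite /f Rplus_0_r ln_1; field.
rewrite {1}/f in e; rewrite /f in e *; nra.
Qed.

(** The right side is the trapezoid rule for the integral of 1/x over [1, 1 + t], an overestimate by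
    convexity; the proof compares derivatives. *)
Lemma ln1p_le t : 0 <= t -> ln (1 + t) <= t / 2 * (1 + / (1 + t)).
Proof.
move=> t0; pose f x := x / 2 * (1 + / (1 + x)) - ln (1 + x).
pose df x := x * x / (2 * ((1 + x) * (1 + x))).
have [||c [hc e]] := MVT_gen f 0 t df; rewrite ?Rmin_left ?Rmax_right //.
- move=> x [x0 _]; rewrite /f /df; auto_derive; [lra | field; lra].
- move=> x [x0 _]; apply/continuity_pt_filterlim.
  apply: ex_derive_continuous; rewrite /f; auto_derive; lra.
rewrite Rmin_left // Rmax_right // in hc.
have : 0 <= df c by apply: Rdiv_le_0_compat; nra.
have : f 0 = 0 by rewrite /f Rplus_0_r ln_1; field.
rewrite /f in e *; nra.
Qed.

(** The decrement equals (n + 1/2) ln (1 + 1/n) - 1. Its upper bound telescopes, which keeps the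
    total decrease finite. *)
Lemma stirling_log_step n : (0 < n)%N ->
  0 <= stirling_log n - stirling_log n.+1 <= / (4 * INR n) - / (4 * INR n.+1).
Proof.
move=> n0; have np : 0 < INR n by apply: lt_0_INR; apply/ltP.
have nS := S_INR n; have f0 := INR_fact_gt0 n.
rewrite /stirling_log INR_factS ln_mult //; last by rewrite nS; lra.
have e : ln (INR n.+1) = ln (INR n) + ln (1 + / INR n).
  rewrite -ln_mult //; last by have := Rinv_0_lt_compat _ np; lra.
  by congr ln; rewrite nS; field; lra.
have i0 : 0 <= / INR n by apply/Rlt_le/Rinv_0_lt_compat.
have := ln1p_ge i0; have := ln1p_le i0; rewrite e nS.
move: (INR n) (ln (1 + _)) np => x l np.
have -> : 2 * / x / (2 + / x) = / (x + / 2) by field; lra.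
have -> : / x / 2 * (1 + / (1 + / x)) =
    (1 + (/ (4 * x) - / (4 * (x + 1)))) / (x + / 2) by field; lra.
move=> h1 h2.
have {}h1 := Rmult_le_compat_l (x + / 2) _ _ ltac:(lra) h1.
have {}h2 := Rmult_le_compat_l (x + / 2) _ _ ltac:(lra) h2.
rewrite Rinv_r in h2; last lra.
have e1 (u : R) : (x + / 2) * (u / (x + / 2)) = u by field; lra.
rewrite e1 in h1; lra.
Qed.

Lemma stirling_log_cvg : exists L : R, is_lim_seq stirling_log L.
Proof.
have cvg : ex_finite_lim_seq (fun n => stirling_log n.+1).
  apply: (ex_finite_lim_seq_decr _ (stirling_log 1 - / 4)) => [n|].
    by have [] := @stirling_log_step n.+1 isT; lra.
  (* Adding 1 / (4 (n + 1)) to the lower bound lets the telescoping estimate drive the induction. *)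
  suff h n : stirling_log 1 - / 4 + / (4 * INR n.+1) <= stirling_log n.+1.
    move=> n; have := h n; have : 0 < / (4 * INR n.+1).
      apply: Rinv_0_lt_compat; apply: Rmult_lt_0_compat; first lra.
      by apply: lt_0_INR; apply/ltP.
    lra.
  elim: n => [|n IH]; first by rewrite /= Rmult_1_r; lra.
  by have [_] := @stirling_log_step n.+1 isT; lra.
by case: cvg => L hL; exists L; apply/is_lim_seq_incr_1.
Qed.

Lemma exp_stirling_log n : (0 < n)%N ->
  exp (stirling_log n) * exp (stirling_log n) =
  (INR n`! * INR n`!) / ((INR n ^ n * INR n ^ n) * INR n * (exp (- INR n) * exp (- INR n))).
Proof.
move=> n0; have np : 0 < INR n by apply: lt_0_INR; apply/ltP.
have f0 := INR_fact_gt0 n; have pn := pow_lt _ n np.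
have e0 := exp_pos (- INR n).
rewrite -exp_plus -[RHS]exp_ln; last first.
  by apply: Rdiv_lt_0_compat; repeat apply: Rmult_lt_0_compat.
congr exp; rewrite ln_div; try by repeat apply: Rmult_lt_0_compat.
rewrite !ln_mult // ?ln_exp ?ln_pow //; try by repeat apply: Rmult_lt_0_compat.
by rewrite /stirling_log; field.
Qed.

(** Powers of n and exponentials cancel in this ratio, leaving n times a squared central binomial
    coefficient over 2 * 16^n, which [wallis_even] rewrites. If E tends to C, the ratio tends to 1 /
    C. *)
Lemma stirling_log_double n : (0 < n)%N ->
  let E k := exp (stirling_log k) * exp (stirling_log k) in
  E n.*2 / (E n * E n) =
  2 / (PI * PI) * (INR n * (wallis n.*2 * wallis n.*2)).
Proof.
move=> n0 E; rewrite /E !exp_stirling_log ?double_gt0 //.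
have np : 0 < INR n by apply: lt_0_INR; apply/ltP.
have f0 := INR_fact_gt0 n; have pn := pow_lt _ n np.
have e0 := exp_pos (- INR n); have pi0 := PI_RGT_0.
have q0 : 0 < 4 ^ n by apply: pow_lt; lra.
have e1 : INR n.*2 = 2 * INR n by rewrite -muln2 -multE mult_INR /=; lra.
have -> : wallis n.*2 =
    INR (n.*2)`! * (PI / 2) / (4 ^ n * (INR n`! * INR n`!)).
  by rewrite -wallis_even; field; repeat split; apply: Rgt_not_eq.
have -> : INR n.*2 ^ n.*2 = 4 ^ n * (INR n ^ n * INR n ^ n).
  rewrite e1 Rpow_mult_distr -addnn -plusE !pow_add -Rpow_mult_distr.
  by congr (_ ^ _ * _); lra.
have -> : exp (- INR n.*2) = exp (- INR n) * exp (- INR n).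
  by rewrite -exp_plus e1; congr exp; lra.
rewrite e1; field; repeat split; apply: Rgt_not_eq => //.
Qed.

Lemma wallis_limit :
  is_lim_seq (fun n => INR n * (wallis n.*2 * wallis n.*2)) (PI / 4).
Proof.
have lim1 : is_lim_seq (fun n => PI / 4 * (1 - / (2 * INR n + 1))) (PI / 4).
  have {2}-> : PI / 4 = PI / 4 * (1 - 0) by lra.
  apply: (is_lim_seq_scal_l _ _ (Finite (1 - 0))).
  apply: is_lim_seq_minus'; first exact: is_lim_seq_const.
  have -> : Finite 0 = Rbar_inv p_infty by [].
  apply: is_lim_seq_inv => //.
  apply: (is_lim_seq_plus _ _ p_infty 1 p_infty) => //; last exact: is_lim_seq_const.
  apply: (is_lim_seq_mult _ _ 2 p_infty p_infty).
  - exact: is_lim_seq_const.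
  - exact: is_lim_seq_INR.
  - by apply/is_Rbar_mult_sym/is_Rbar_mult_p_infty_pos; rewrite /=; lra.
apply: (is_lim_seq_le_le_loc _ _ _ _ _ lim1 (is_lim_seq_const (PI / 4))).
exists 1%N => n /leP n0; have np : 0 < INR n by apply: lt_0_INR; apply/ltP.
have [] := @wallis_sqr_bounds n.*2; first by rewrite double_gt0.
have e1 : INR n.*2 = 2 * INR n by rewrite -muln2 -multE mult_INR /=; lra.
rewrite S_INR e1 => h1 h2.
have {}h1 := Rmult_le_compat_l _ _ _ (Rlt_le _ _ np) h1.
have {}h2 := Rmult_le_compat_l _ _ _ (Rlt_le _ _ np) h2.
split; [move: h1 | move: h2]; set w := _ * (wallis _ * wallis _).
  by have -> : INR n * (PI / 2 / (2 * INR n + 1)) =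
    PI / 4 * (1 - / (2 * INR n + 1)) by field; lra.
by have -> : INR n * (PI / 2 / (2 * INR n)) = PI / 4 by field; lra.
Qed.

(** The ratio of [stirling_log_double] tends both to 1 / C and, by [wallis_limit], to 1 / (2 PI). *)
Lemma stirling_log_limit :
  is_lim_seq (fun n => exp (stirling_log n) * exp (stirling_log n)) (2 * PI).
Proof.
have [L hL] := stirling_log_cvg; pose C := exp L * exp L.
have C0 : 0 < C by apply: Rmult_lt_0_compat; exact: exp_pos.
have pi0 := PI_RGT_0.
pose E n := exp (stirling_log n) * exp (stirling_log n).
have hE : is_lim_seq E C.
  have he : is_lim_seq (fun n => exp (stirling_log n)) (exp L).
    apply: (is_lim_seq_continuous exp _ _ _ hL).
    exact/derivable_continuous_pt/derivable_pt_exp.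
  exact: is_lim_seq_mult'.
have hE2 : is_lim_seq (fun n => E n.*2) C.
  apply: (is_lim_seq_subseq E C double) hE; apply: eventually_subseq => n.
  by apply/ltP; rewrite ltn_double.
have lim1 : is_lim_seq (fun n => E n.*2 / (E n * E n)) (C / (C * C)).
  by apply: is_lim_seq_div' => //; [exact: is_lim_seq_mult' | nra].
have lim2 : is_lim_seq (fun n => E n.*2 / (E n * E n)) (2 / (PI * PI) * (PI / 4)).
  apply: is_lim_seq_ext_loc (is_lim_seq_scal_l _ (2 / (PI * PI)) _ wallis_limit).
  by exists 1%N => n /leP n0; rewrite -stirling_log_double.
have := is_lim_seq_unique _ _ lim1; rewrite (is_lim_seq_unique _ _ lim2) => -[e].
suff -> : 2 * PI = C by [].
have e1 : / C = / (2 * PI).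
  have -> : / C = C / (C * C) by field; lra.
  by rewrite -e; field; lra.
by rewrite -[C]Rinv_inv e1 Rinv_inv.
Qed.

Lemma stirling :
  Un_cv (fun m : nat => (INR m`! / INR m ^ m)
                        / (sqrt (2 * PI * INR m) * exp (- INR m))) 1.
Proof.
apply/is_lim_seq_Reals; have pi0 := PI_RGT_0.
pose E n := exp (stirling_log n) * exp (stirling_log n).
have lim1 : is_lim_seq (fun n => sqrt (E n / (2 * PI))) (sqrt 1).
  apply: (is_lim_seq_continuous sqrt); first by apply: continuity_pt_sqrt; lra.
  have -> : 1 = 2 * PI / (2 * PI) by field; lra.
  apply: is_lim_seq_div'; [exact: stirling_log_limit | exact: is_lim_seq_const | lra].
rewrite sqrt_1 in lim1; apply: is_lim_seq_ext_loc lim1.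
exists 1%N => n /leP n0; have np : 0 < INR n by apply: lt_0_INR; apply/ltP.
have f0 := INR_fact_gt0 n; have pn := pow_lt _ n np; have e0 := exp_pos (- INR n).
have s0 : 0 < sqrt (2 * PI * INR n).
  by apply: sqrt_lt_R0; repeat apply: Rmult_lt_0_compat => //; lra.
apply: sqrt_lem_1.
- apply: Rdiv_le_0_compat; last lra.
  by apply/Rlt_le/Rmult_lt_0_compat; exact: exp_pos.
- by apply/Rlt_le/Rdiv_lt_0_compat; [apply: Rdiv_lt_0_compat | apply: Rmult_lt_0_compat].
rewrite /E exp_stirling_log //.
have ss : sqrt (2 * PI * INR n) * sqrt (2 * PI * INR n) = 2 * PI * INR n.
  by apply: sqrt_def; apply: Rlt_le; repeat apply: Rmult_lt_0_compat => //; lra.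
have -> (a b : R) : b <> 0 -> a <> 0 -> (INR n`! / a / (sqrt (2 * PI * INR n) * b)) *
   (INR n`! / a / (sqrt (2 * PI * INR n) * b)) = INR n`! * INR n`! /
   (a * a * ((sqrt (2 * PI * INR n) * sqrt (2 * PI * INR n)) * (b * b))).
  by move=> b0 a0; field; repeat split => //; apply: Rgt_not_eq.
- by rewrite ss; field; repeat split; apply: Rgt_not_eq.
- exact: Rgt_not_eq.
- exact: Rgt_not_eq.
Qed.
End Stirling.

From mathcomp Require Import complex lra.
Import Order.TTheory GRing.Theory Num.Theory.
Local Open Scope ring_scope.

(** * Sums of principal minors and elementary symmetric polynomials *)

Section MinorSum.
Variable R : comNzRingType.
Implicit Types (j m n : nat).

(** Non-injective maps contribute 0 and each j-subset is counted j! times. Summing over all maps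
    lets Leibniz expansions be reindexed freely. *)
Definition minor_sum j n (A : 'M[R]_n) : R :=
  \sum_(s : {ffun 'I_j -> 'I_n}) \det (mxsub s s A).

Lemma minor_sum_mulmxE j m n (A : 'M[R]_(m, n)) (B : 'M[R]_(n, m)) :
  minor_sum j (A *m B) =
  \sum_(sg : 'S_j) \sum_(s : {ffun 'I_j -> 'I_m}) \sum_(t : {ffun 'I_j -> 'I_n})
    (-1) ^+ sg * ((\prod_i A (s i) (t i)) * \prod_i B (t i) (s (sg i))).
Proof.
rewrite exchange_big; apply: eq_bigr => s _; apply: eq_bigr => sg _.
rewrite -big_distrr /=; congr (_ * _).
under eq_bigr do rewrite !mxE.
rewrite bigA_distr_bigA; apply: eq_bigr => t _; exact: big_split.
Qed.

(** For each fixed permutation [sg], exchange the roles of s and t in the Leibniz expansion and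
    replace t by its composite with the inverse of [sg]. *)
Lemma minor_sum_mulmxC j m n (A : 'M[R]_(m, n)) (B : 'M[R]_(n, m)) :
  minor_sum j (A *m B) = minor_sum j (B *m A).
Proof.
rewrite !minor_sum_mulmxE; apply: eq_bigr => sg _.
rewrite [RHS]exchange_big; apply: eq_bigr => s _.
have sgK : {on predT, bijective
    (fun t : {ffun 'I_j -> 'I_n} => [ffun i => t ((sg^-1)%g i)])}.
  apply: onW_bij; exists (fun t : {ffun 'I_j -> 'I_n} => [ffun i => t (sg i)]).
    by move=> t; apply/ffunP => i; rewrite !ffunE permK.
  by move=> t; apply/ffunP => i; rewrite !ffunE permKV.
rewrite [RHS](reindex _ sgK); apply: eq_bigr => t _; congr (_ * _).
rewrite [LHS]mulrC; congr (_ * _).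
  rewrite [RHS](reindex_inj (@perm_inj _ sg)).
  by apply: eq_bigr => i _; rewrite ffunE permK.
by apply: eq_bigr => i _; rewrite ffunE permK.
Qed.

Lemma det_mxsub_mul_diag j n (l : 'rV[R]_n) (A : 'M[R]_n) (s : 'I_j -> 'I_n) :
  \det (mxsub s s (diag_mx l *m A)) = (\prod_i l 0 (s i)) * \det (mxsub s s A).
Proof.
have -> : mxsub s s (diag_mx l *m A) =
          diag_mx (\row_i l 0 (s i)) *m mxsub s s A.
  by apply/matrixP=> a b; rewrite mul_diag_mx mxE mul_diag_mx !mxE.
rewrite det_mulmx det_diag; congr (_ * _).
by apply: eq_bigr => i _; rewrite mxE.
Qed.

Lemma det_mxsub_noninj j n (A : 'M[R]_n) (s : {ffun 'I_j -> 'I_n}) :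
  ~~ injectiveb s -> \det (mxsub s s A) = 0.
Proof.
move=> /injectivePn [a [b nab eqs]].
by apply: (determinant_alternate nab) => i; rewrite !mxE eqs.
Qed.

Lemma minor_sum_diag j n (l : 'rV[R]_n) :
  minor_sum j (diag_mx l) =
  \sum_(s : {ffun 'I_j -> 'I_n} | injectiveb s) \prod_i l 0 (s i).
Proof.
rewrite /minor_sum (bigID (fun s : {ffun 'I_j -> 'I_n} => injectiveb s)) /=.
rewrite [X in _ + X]big1 ?addr0; last by move=> s; exact: det_mxsub_noninj.
apply: eq_bigr => s /injectiveP injs.
rewrite -[diag_mx l]mulmx1 det_mxsub_mul_diag.
have -> : mxsub s s (1%:M : 'M[R]_n) = 1%:M.
  by apply/matrixP=> a b; rewrite !mxE (inj_eq injs).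
by rewrite det1 mulr1.
Qed.

Definition esym j (s : seq R) : R := (\prod_(a <- s) (1 + a *: 'X))`_j.

Lemma perm_esym j (s t : seq R) : perm_eq s t -> esym j s = esym j t.
Proof. by move=> st; rewrite /esym (perm_big _ st). Qed.

Lemma esym_nil j : esym j [::] = (j == 0%N)%:R.
Proof. by rewrite /esym big_nil coef1. Qed.

Lemma esym0 s : esym 0 s = 1.
Proof.
elim: s => [|a s IH]; first by rewrite esym_nil.
rewrite /esym big_cons mulrDl mul1r coefD -scalerAl coefZ coefXM /= mulr0 addr0.
exact: IH.
Qed.

Lemma esymS j a s : esym j.+1 (a :: s) = esym j.+1 s + a * esym j s.
Proof. by rewrite /esym big_cons mulrDl mul1r coefD -scalerAl coefZ coefXM. Qed.

(** Expanding the product gives one monomial per subset A; grouping injective maps by image, each A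
    of size j is hit by j! of them. *)
Lemma esym_sum_inj j n (l : 'I_n -> R) :
  \sum_(s : {ffun 'I_j -> 'I_n} | injectiveb s) \prod_i l (s i) =
  (j`!)%:R * esym j [seq l i | i <- enum 'I_n].
Proof.
rewrite /esym big_map big_enum /=.
under [in RHS]eq_bigr do rewrite addrC.
rewrite bigA_distr /= coef_sum big_distrr /=.
rewrite (partition_big (fun s : {ffun 'I_j -> 'I_n} => s @: setT) xpredT) //=.
apply: eq_bigr => A _.
have -> : \prod_i (if i \in A then l i *: 'X else 1) =
          (\prod_(i in A) l i) *: 'X^#|A| :> {poly R}.
  by rewrite -big_mkcond /= scaler_prod prodr_const.
rewrite coefZ coefXn.
have [cA|ncA] := eqVneq j #|A|; last first.
  rewrite !mulr0 big_pred0 // => s; apply/negbTE/negP => /andP[/injectiveP injs].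
  by move=> /eqP sA; move/eqP: ncA; rewrite -sA card_imset // cardsT card_ord.
rewrite mulr1; transitivity
    (\sum_(s : {ffun 'I_j -> 'I_n} | injectiveb s && (s @: setT == A))
       \prod_(i in A) l i).
  apply: eq_bigr => s /andP[/injectiveP injs /eqP <-].
  rewrite big_imset /=; last by move=> a b _ _; exact: injs.
  by apply: eq_bigl => i; rewrite inE.
rewrite sumr_const mulr_natl; congr (_ *+ _).
have := card_inj_ffuns_on 'I_j (mem A); rewrite card_ord -cA ffactnn => <-.
rewrite -sum1_card -[X in _ = X]sum1_card; apply: eq_bigl => s; rewrite !inE.
apply/andP/andP => -[].
  move=> injs /eqP <-; split=> //; apply/ffun_onP => i; exact: imset_f.
move=> /ffun_onP sA injs; split=> //; rewrite eqEcard; apply/andP; split.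
  by apply/subsetP => _ /imsetP[i _ ->]; exact: sA.
by rewrite card_imset ?cardsT ?card_ord ?cA //; exact/injectiveP.
Qed.
End MinorSum.

Lemma minor_sum_gt_size (R : comNzRingType) j n (A : 'M[R]_n) :
  (n < j)%N -> minor_sum j A = 0.
Proof.
move=> nj; apply: big1 => s _; apply: det_mxsub_noninj.
apply/negP => /injectiveP/leq_card; by rewrite !card_ord leqNgt nj.
Qed.

(** An injective self-map is a permutation, and permuting rows and columns alike multiplies the
    determinant by a squared sign. *)
Lemma minor_sum_size (R : comNzRingType) n (A : 'M[R]_n) :
  minor_sum n A = n`!%:R * \det A.
Proof.
rewrite /minor_sum (bigID (fun s : {ffun 'I_n -> 'I_n} => injectiveb s)) /=.
rewrite [X in _ + X]big1 ?addr0; last by move=> s; exact: det_mxsub_noninj.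
rewrite (eq_bigr (fun=> \det A)); last first.
  move=> s /injectiveP injs.
  have -> : mxsub s s A = row_perm (perm injs) (col_perm (perm injs) A).
    by apply/matrixP => a b; rewrite !mxE !permE.
  rewrite row_permE col_permE !det_mulmx !det_perm odd_permV.
  by rewrite mulrCA -expr2 sqrr_sign mulr1.
rewrite sumr_const mulr_natl; congr (_ *+ _).
rewrite -[n in RHS]card_ord -ffactnn -card_inj_ffuns.
by apply: eq_card => s; rewrite inE.
Qed.

(** * Spectrum of a real positive semidefinite matrix *)

Lemma char_poly_conj (R : comUnitRingType) n (P A : 'M[R]_n) :
  P \in unitmx -> char_poly (invmx P *m A *m P) = char_poly A.
Proof.
move=> Pu; pose Q := map_mx polyC P; pose Q' := map_mx polyC (invmx P).
have Q'Q : Q' *m Q = 1%:M by rewrite -map_mxM mulVmx // map_mx1.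
have -> : char_poly (invmx P *m A *m P) = \det (Q' *m char_poly_mx A *m Q).
  congr (\det _); rewrite /char_poly_mx mulmxBr mulmxBl !map_mxM; congr (_ - _).
  by rewrite mul_mx_scalar -scalemxAl Q'Q scalemx1.
by rewrite !det_mulmx mulrAC -det_mulmx Q'Q det1 mul1r.
Qed.

Section Spectrum.
Variable F : rcfType.
Local Notation toC := (real_complex F).

(** The spectral theorem is applied over the complex extension, where X is Hermitian; its
    eigenvalues are real, and injectivity of the embedding brings the identities back to F. *)
Lemma sym_psd_spectrum n (X : 'M[F]_n) :
  X^T = X -> (forall x : 'cV_n, 0 <= (x^T *m X *m x) 0 0) ->
  exists l : 'rV[F]_n, [/\ forall i, 0 <= l 0 i,
    char_poly X = \prod_i ('X - (l 0 i)%:P)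
    & forall j, minor_sum j X = minor_sum j (diag_mx l)].
Proof.
move=> symX posX; pose XC : 'M[F[i]]_n := map_mx toC X.
have hermX : XC \is hermsymmx.
  apply: realsym_hermsym.
    by apply/is_hermitianmxP; rewrite expr0 scale1r map_mx_id // map_trmx symX.
  by apply/mxOverP => a b; rewrite mxE complex_real.
have /orthomx_spectralP XCE := hermitian_normalmx hermX.
have := hermitian_spectral_diag_real hermX.
have := spectral_unitarymx XC.
move: (spectralmx XC) (spectral_diag XC) XCE => P sp XCE uP /mxOverP rsp.
pose l : 'rV[F]_n := \row_i complex.Re (sp 0 i).
have spE : sp = map_mx toC l.
  by apply/rowP => i; rewrite !mxE /= RRe_real.
have Pu := unitarymx_unit uP.
exists l; split.
- move=> i.
  have spi : sp 0 i = (P *m XC *m map_mx conjc (P^T)) i i.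
    have -> : map_mx conjc P^T = invmx P by rewrite invmx_unitary.
    rewrite XCE !mulmxA mulmxV // mul1mx mulmxK //.
    by rewrite mxE eqxx.
  pose a : 'cV_n := \col_u complex.Re (P i u).
  pose b : 'cV_n := \col_u complex.Im (P i u).
  (* Taking real parts of the Hermitian form at row i of P discards the cross terms and leaves the
     real forms at its real and imaginary parts. *)
  have -> : l 0 i = (a^T *m X *m a) 0 0 + (b^T *m X *m b) 0 0.
    rewrite mxE spi !mxE raddf_sum -big_split /=; apply: eq_bigr => v _.
    rewrite !mxE !big_distrl raddf_sum -big_split /=; apply: eq_bigr => u _.
    rewrite !mxE /=; case: (P i u) (P i v) => p q [p' q'] /=.
    by rewrite !mulr0 add0r subr0 mulrN opprK.
  by rewrite addr_ge0.
- apply: (@map_poly_inj _ _ toC).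
  rewrite map_char_poly map_prod_XsubC -/XC XCE char_poly_conj //.
  rewrite char_poly_trig ?diag_mx_is_trig //.
  by apply: eq_bigr => i _; rewrite mxE eqxx spE mxE.
- have map_minor_sum k (Y : 'M[F]_n) : toC (minor_sum k Y) = minor_sum k (map_mx toC Y).
    rewrite rmorph_sum; apply: eq_bigr => s _; by rewrite -det_map_mx map_mxsub.
  move=> j; apply: (@complexI F); rewrite !map_minor_sum map_diag_mx -spE -/XC XCE.
  by rewrite minor_sum_mulmxC mulmxA mulmxV // mul1mx.
Qed.
End Spectrum.

(** * Inequalities for elementary symmetric polynomials *)

Lemma esym_gt_size (R : comNzRingType) j (s : seq R) :
  (size s < j)%N -> esym j s = 0.
Proof.
elim: s j => [|a s IH] [|j] //=; first by rewrite esym_nil.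
by move=> h; rewrite esymS !IH ?mulr0 ?addr0 // ltnW.
Qed.

Lemma esym_size (R : comNzRingType) (s : seq R) :
  esym (size s) s = \prod_(a <- s) a.
Proof.
elim: s => [|a s IH]; first by rewrite esym0 big_nil.
by rewrite esymS big_cons IH esym_gt_size // add0r.
Qed.

Lemma esym_cat0 (R : comNzRingType) j (s t : seq R) :
  {in t, forall a, a = 0} -> esym j (s ++ t) = esym j s.
Proof.
move=> t0; rewrite /esym big_cat /= [X in _ * X]big_seq.
by rewrite [X in _ * X]big1 ?mulr1 // => a /t0 ->; rewrite scale0r addr0.
Qed.

Lemma esymZ (R : comNzRingType) (a : R) j s :
  esym j [seq a * b | b <- s] = a ^+ j * esym j s.
Proof.
elim: s j => [|b s IH] [|j] /=; rewrite ?esym0 ?expr0 ?mulr1 //.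
  by rewrite !esym_nil mulr0.
by rewrite !esymS !IH exprS mulrDr; congr (_ + _); rewrite mulrACA.
Qed.

Section EsymOrder.
Variable F : realFieldType.
Implicit Types (s : seq F) (j k r : nat).

Lemma esym_ge0 j s : {in s, forall a, 0 <= a} -> 0 <= esym j s.
Proof.
elim: s j => [|a s IH] [|j] h; rewrite ?esym0 ?esym_nil //.
have hs : {in s, forall a, 0 <= a} by move=> b bs; rewrite h // inE bs orbT.
by rewrite esymS addr_ge0 ?mulr_ge0 ?IH // h // inE eqxx.
Qed.

(** The left side collects the monomials of e_j that contain all of the first k entries; the
    remaining ones are nonnegative. *)
Lemma prod_take_esym_drop k j s : {in s, forall a, 0 <= a} ->
  (k <= j)%N -> (k <= size s)%N ->
  (\prod_(a <- take k s) a) * esym (j - k) (drop k s) <= esym j s.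
Proof.
elim: k j s => [|k IH] j s h; first by rewrite take0 drop0 big_nil mul1r subn0.
case: s h => [|a s] h; case: j => [|j] //= kj ks.
have hs : {in s, forall a, 0 <= a} by move=> b bs; rewrite h // inE bs orbT.
rewrite big_cons subSS esymS -mulrA; apply: ler_wpDl; first exact: esym_ge0.
by rewrite ler_wpM2l ?IH // h // inE eqxx.
Qed.

(* If N is the number of successes of independent trials with success
   probabilities s, then esym r s = E[C(N, r)], and C(N, r) >= 1 + N - r. *)
Lemma esym_ge_linear r s : {in s, forall a, 0 <= a <= 1} ->
  1 + (\sum_(a <- s) a) - r.+1%:R <= esym r.+1 s.
Proof.
elim: s r => [|z s IH] r h.
  by rewrite big_nil esym_nil addr0 subr_le0 ler1n.
have hs : {in s, forall a, 0 <= a <= 1}.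
  by move=> b bs; rewrite h // inE bs orbT.
have /andP[z0 z1] : 0 <= z <= 1 by rewrite h // inE eqxx.
have e0 k : 0 <= esym k s by apply: esym_ge0 => b /hs /andP[].
rewrite big_cons esymS.
case: r => [|r]; first by have := IH 0%N hs; rewrite esym0; lra.
have := IH r.+1 hs; have := IH r hs; have := e0 r.+1; have := e0 r.+2.
rewrite -[r.+2%:R]natr1.
move: (\sum_(a <- s) a) (r.+1%:R : F) (esym r.+1 s) (esym r.+2 s) => S q u v.
move=> v0 u0 hu hv.
(* Let w = 1 + S - q, the bound on u. If w < 0 the left side is negative; if w >= 1 then z u >= z;
   in between, v >= 0 and (1 - z)(1 - w) >= 0 suffice. *)
have [Sq|Sq] := leP 0 (1 + S - q); last by have := mulr_ge0 z0 u0; lra.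
have [S1|S1] := leP 1 (1 + S - q).
  by have := ler_wpM2l z0 (le_trans S1 hu); lra.
have h1 := ler_wpM2l z0 hu.
have h2 : 0 <= (1 - z) * (1 - (1 + S - q)) by rewrite mulr_ge0 // subr_ge0 // ltW.
lra.
Qed.

(** Dividing by a puts the entries in [0, 1] with sum r + 1, where the linear bound equals 1. This
    compares a tail with copies of its average. *)
Lemma esym_ge_cap r a s : 0 < a -> {in s, forall b, 0 <= b <= a} ->
  \sum_(b <- s) b = r.+1%:R * a -> a ^+ r.+1 <= esym r.+1 s.
Proof.
move=> a0 hs sum_s; pose t := [seq a^-1 * b | b <- s].
have -> : s = [seq a * b | b <- t].
  by rewrite -map_comp map_id_in // => b _ /=; rewrite mulVKf // gt_eqF.
rewrite esymZ ler_pMr ?exprn_gt0 //.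
have ht : {in t, forall b, 0 <= b <= 1}.
  move=> _ /mapP[b /hs /andP[b0 ba] ->].
  by rewrite mulr_ge0 ?invr_ge0 // ?(ltW a0) //= ler_pdivrMl // mulr1.
apply: le_trans (esym_ge_linear r ht).
by rewrite big_map -mulr_sumr sum_s mulrCA mulVf ?gt_eqF // mulr1 addrK.
Qed.

Lemma prod_le_avg s : {in s, forall a, 0 <= a} ->
  \prod_(a <- s) a <= ((\sum_(a <- s) a) / (size s)%:R) ^+ size s.
Proof.
move=> h; rewrite [X in X <= _](big_nth 0) big_mkord.
rewrite [X in _ <= (X / _) ^+ _](big_nth 0) big_mkord.
have := @leif_AGM F _ (mem 'I_(size s)) (fun i => nth 0 s i).
rewrite card_ord => /(_ _)/leif_le; apply => i _; exact/h/mem_nth.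
Qed.

End EsymOrder.

(** * The real numbers as a real closed field *)

Lemma RlebP x y : reflect (Rle x y) (Rleb x y).
Proof. by rewrite /Rleb; case: Rle_dec => h; constructor. Qed.

Lemma RltbP x y : reflect (Rlt x y) (Rltb x y).
Proof. by rewrite /Rltb; case: Rlt_dec => h; constructor. Qed.

Lemma Rleb_add x y : Rleb 0 x -> Rleb 0 y -> Rleb 0 (x + y).
Proof. by move=> /RlebP hx /RlebP hy; apply/RlebP; exact: Rplus_le_le_0_compat. Qed.

Lemma Rleb_mul x y : Rleb 0 x -> Rleb 0 y -> Rleb 0 (x * y).
Proof. by move=> /RlebP hx /RlebP hy; apply/RlebP; exact: Rmult_le_pos. Qed.

Lemma Rleb_anti x : Rleb 0 x -> Rleb x 0 -> x = 0.
Proof. by move=> /RlebP hx /RlebP hy; exact: Rle_antisym. Qed.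

Lemma Rleb_sub x y : Rleb 0 (y - x) = Rleb x y.
Proof.
apply/RlebP/RlebP => [|h].
  by move/(Rplus_le_compat_r x); rewrite -[Rplus (y - x) x]/(y - x + x) subrK Rplus_0_l.
exact: (Rge_le _ _ (Rge_minus _ _ (Rle_ge _ _ h))).
Qed.

Lemma Rleb_total x : Rleb 0 x || Rleb x 0.
Proof. by apply/orP; case: (Rle_or_lt 0 x) => h; [left | right]; apply/RlebP; try exact: Rlt_le. Qed.

Lemma Rleb_norm x : Rleb 0 x -> Rabs x = x.
Proof. by move=> /RlebP h; rewrite Rabs_pos_eq. Qed.

Lemma Rltb_def x y : Rltb x y = (y != x) && Rleb x y.
Proof.
apply/RltbP/andP => [h|[/eqP ne /RlebP h]].
  by split; [apply/eqP => e; apply: (Rlt_not_eq _ _ h) | apply/RlebP/Rlt_le].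
by case: h => // e; case: ne.
Qed.

HB.instance Definition _ := Num.IntegralDomain_isLeReal.Build R
  Rleb_add Rleb_mul Rleb_anti Rleb_sub Rleb_total Rabs_Ropp Rleb_norm Rltb_def.

Lemma continuity_horner (p : {poly R}) : continuity (horner p).
Proof.
elim/poly_ind: p => [|p c IH].
  by apply: continuity_const => x y; rewrite !horner0.
have -> : horner (p * 'X + c%:P) = plus_fct (mult_fct (horner p) id) (fct_cte c).
  by apply: functional_extensionality => x; rewrite hornerMXaddC.
apply: continuity_plus; last exact: continuity_const.
by apply: continuity_mult IH _; apply/derivable_continuous/derivable_id.
Qed.

(** [sym_psd_spectrum] lives over a real closed field; the intermediate value theorem for
    polynomials makes the reals one. *)
Lemma R_real_closed : Num.real_closed_axiom R.
Proof.
move=> p a b /RlebP ab /andP[/RlebP pa /RlebP pb].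
have papb : Rle (Rmult p.[a] p.[b]) 0.
  by rewrite -(Rmult_0_l p.[b]); exact: Rmult_le_compat_r.
have [x [[ax xb] px]] := IVT_cor _ _ _ (continuity_horner p) ab papb.
exists x; first by apply/andP; split; apply/RlebP.
exact/eqP.
Qed.

HB.instance Definition _ := Num.RealField_isClosed.Build R R_real_closed.

Lemma RleP (x y : R) : reflect (Rle x y) (x <= y).
Proof. exact: RlebP. Qed.

Lemma RltP (x y : R) : reflect (Rlt x y) (x < y).
Proof. exact: RltbP. Qed.

(** * Comparison of gamma with elementary symmetric polynomials *)

Lemma INRE n : INR n = n%:R.
Proof. by elim: n => [|n IH] //; rewrite S_INR IH -natr1. Qed.

Lemma RinvE (x : R) : x != 0 -> Rinv x = x^-1.
Proof.
move=> x0; apply: (mulIf x0); rewrite mulVf //; apply: Rinv_l; exact/eqP.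
Qed.

Lemma RdivE (x y : R) : y != 0 -> Rdiv x y = x / y.
Proof. by move=> y0; rewrite /Rdiv RinvE. Qed.

Lemma RpowE (x : R) n : pow x n = x ^+ n.
Proof. by elim: n => [|n IH] //; rewrite exprS -IH. Qed.

Lemma ext_sum_ln_SomeP (s : seq R) g : ext_sum (map ln_ext s) = Some g ->
  {in s, forall a, 0 < a} /\ exp g = \prod_(a <- s) a.
Proof.
elim: s g => [|a s IH] g /=; first by move=> [<-]; rewrite exp_0 big_nil.
rewrite /ln_ext; case: RltbP => //= a0.
case: (ext_sum _) IH => [g'|] //= /(_ _ erefl) [hs eg] [<-]; split.
  by move=> b; rewrite inE => /orP[/eqP ->|/hs //]; apply/RltbP.
by rewrite exp_plus exp_ln // eg big_cons.
Qed.

Lemma ext_sum_ln_pos (s : seq R) : {in s, forall a, 0 < a} ->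
  exists g, ext_sum (map ln_ext s) = Some g.
Proof.
elim: s => [|a s IH] h /=; first by exists R0.
have [|g ->] := IH; first by move=> b bs; rewrite h // inE bs orbT.
rewrite /ln_ext; have -> : Rltb 0 a by apply: (h a); rewrite inE eqxx.
by eexists.
Qed.

Lemma ext_sum_cat s t : ext_sum (s ++ t) = ext_add (ext_sum s) (ext_sum t).
Proof.
elim: s => [|a s IH] /=; first by case: (ext_sum t) => //= x; rewrite Rplus_0_l.
rewrite IH; case: a (ext_sum s) (ext_sum t) => [a|] [x|] [y|] //=.
by rewrite Rplus_assoc.
Qed.

(* If no index below j satisfies gamma_cond, then gamma_k is j and this list
   consists of the j largest entries; both comparisons of gamma with esym
   below cover this junk case. *)
Definition flatten_tail (j k : nat) (y : seq R) : seq R :=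
  take k y ++ nseq (j - k) (Rdiv (tail_sum y k) (INR (j - k))).

Lemma gammaE j x : let y := sort_desc x in
  gamma j x = ext_sum (map ln_ext (flatten_tail j (gamma_k j y) y)).
Proof. by rewrite /= map_cat map_nseq ext_sum_cat. Qed.

Lemma tail_sumE y k : tail_sum y k = \sum_(a <- drop k y) a.
Proof. by rewrite unlock /reducebig. Qed.

Lemma sort_desc_sorted x : sorted >=%R (sort_desc x).
Proof. by apply: sort_sorted => a b; exact: le_total. Qed.

Lemma perm_sort_desc x : perm_eq (sort_desc x) x.
Proof. by rewrite perm_sort. Qed.

Lemma gamma_k_le j y : (gamma_k j y <= j)%N.
Proof. by rewrite -[j in leqRHS](size_iota 0) find_size. Qed.

(** The second half of [gamma_cond]: it supplies the cap hypothesis of [esym_ge_cap] for the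
    tail. *)
Lemma gamma_k_cap j y : (gamma_k j y < j)%N ->
  nth 0 y (gamma_k j y) <= Rdiv (tail_sum y (gamma_k j y)) (INR (j - gamma_k j y)).
Proof.
move=> kj; have : has (gamma_cond j y) (iota 0 j) by rewrite has_find size_iota.
by move=> /(nth_find 0%N); rewrite -/(gamma_k j y) nth_iota // => /andP[].
Qed.

Lemma sorted_nth_max (y : seq R) k : sorted >=%R y ->
  {in drop k y, forall a, a <= nth 0 y k}.
Proof.
move=> sy a; have := drop_sorted k sy.
rewrite -[k in nth _ _ k]addn0 -nth_drop.
case: (drop k y) => //= b t /(order_path_min (rev_trans le_trans))/allP h.
by rewrite inE => /orP[/eqP -> //|/h].
Qed.

(** Keep only the monomials containing the k largest entries; the tail is capped by its average, so
    [esym_ge_cap] bounds its factor. *)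
Lemma exp_gamma_le_esym j x g : {in x, forall a, 0 <= a} -> (j <= size x)%N ->
  gamma j x = Some g -> exp g <= esym j x.
Proof.
move=> x0 jx; rewrite gammaE; have yx := perm_sort_desc x.
rewrite -(perm_esym _ yx).
have sy := sort_desc_sorted x.
have y0 : {in sort_desc x, forall a, 0 <= a}.
  by move=> a; rewrite (perm_mem yx); exact: x0.
rewrite -(perm_size yx) in jx.
move: (sort_desc x) sy y0 jx => y sy y0 jy {yx x0}.
move=> /ext_sum_ln_SomeP [pos ->].
have kj := gamma_k_le j y; have cap := @gamma_k_cap j y.
move: (gamma_k j y) kj cap pos => k kj cap pos.
apply: le_trans (prod_take_esym_drop y0 kj (leq_trans kj jy)).
rewrite big_cat; apply: ler_wpM2l.
  by rewrite big_seq prodr_ge0 // => a /mem_take/y0.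
rewrite big_nseq iter_mulr_1.
case: (leqP j k) => [jk|ltkj].
  by have -> : (j - k)%N = 0%N; [apply/eqP | rewrite expr0 esym0].
(* The average belongs to the flattened list, and finiteness of gamma makes it positive. *)
have := cap ltkj; have : Rdiv (tail_sum y k) (INR (j - k)) \in
    flatten_tail j k y by rewrite mem_cat mem_nseq subn_gt0 ltkj eqxx orbT.
move=> /pos; rewrite -[(j - k)%N]prednK ?subn_gt0 // INRE RdivE ?pnatr_eq0 //.
rewrite tail_sumE => avg0 ky; apply: esym_ge_cap => //.
  move=> a ay; rewrite y0 ?(mem_drop ay) //=.
  exact: le_trans (sorted_nth_max sy ay) ky.
by rewrite mulrCA mulfV ?mulr1 // pnatr_eq0.
Qed.

(* If at most j entries are nonzero, esym j is their product, and the
   inequality between arithmetic and geometric means bounds it. *)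
Lemma esym_le_exp_gamma j x : {in x, forall a, 0 <= a} -> (j <= size x)%N ->
  esym j.+1 x = 0 -> 0 < esym j x ->
  exists2 g, gamma j x = Some g & esym j x <= exp g.
Proof.
move=> x0 jx; rewrite gammaE; have yx := perm_sort_desc x.
rewrite -!(perm_esym _ yx).
have sy := sort_desc_sorted x.
have y0 : {in sort_desc x, forall a, 0 <= a}.
  by move=> a; rewrite (perm_mem yx); exact: x0.
rewrite -(perm_size yx) in jx.
move: (sort_desc x) sy y0 jx => y sy y0 jy {yx x0} eS0 e_gt0.
have drop0 : {in drop j y, forall a, a = 0}.
  have [yj|ltjy] := leqP (size y) j; first by rewrite drop_oversize.
  (* With zero-based indices this is the (j+1)-st largest entry; were it positive, the j + 1 largest
     would have a positive product, bounded by e_(j+1) = 0. *)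
  suff nth0 : nth 0 y j = 0.
    move=> a aj; apply/eqP; rewrite eq_le y0 ?(mem_drop aj) // andbT -nth0.
    exact: sorted_nth_max.
  apply/eqP; rewrite eq_le y0 ?mem_nth // andbT leNgt; apply/negP => nth_gt0.
  have := prod_take_esym_drop y0 (leqnn j.+1) ltjy.
  rewrite subnn esym0 mulr1 eS0 leNgt big_seq prodr_gt0 // => a.
  move=> /(nthP 0)[i ]; rewrite size_takel // => ij <-; rewrite nth_take //.
  apply: lt_le_trans nth_gt0 _.
  by apply: (sorted_leq_nth (rev_trans le_trans) lexx 0 sy); rewrite ?inE //;
    apply: leq_ltn_trans ltjy.
have eE : esym j y = \prod_(a <- take j y) a.
  by rewrite -{1}(cat_take_drop j y) esym_cat0 // -{1}(size_takel jy) esym_size.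
have take_gt0 : {in take j y, forall a, 0 < a}.
  move=> a ay; rewrite lt_neqAle y0 ?(mem_take ay) // andbT eq_sym.
  apply/negP => /eqP a0; move: e_gt0.
  by rewrite eE (big_rem a) //= a0 mul0r ltxx.
(* From here k is an arbitrary index at most j. *)
have kj := gamma_k_le j y; move: (gamma_k j y) kj => k kj.
have takeE : take j y = take k y ++ take (j - k) (drop k y).
  by rewrite -takeD subnKC.
set w := take (j - k) (drop k y) in takeE.
have sw : size w = (j - k)%N by rewrite size_takel // size_drop leq_sub2r.
have tailE : tail_sum y k = \sum_(a <- w) a.
  rewrite tail_sumE -{1}(cat_take_drop (j - k) (drop k y)) big_cat /= -/w.
  rewrite [X in _ + X]big_seq [X in _ + X]big1 ?addr0 // => a.
  by rewrite drop_drop subnK //; exact: drop0.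
have w_gt0 : {in w, forall a, 0 < a}.
  by move=> a aw; rewrite take_gt0 // takeE mem_cat aw orbT.
have prod_w : \prod_(a <- w) a <=
    Rdiv (tail_sum y k) (INR (j - k)) ^+ (j - k).
  have [jk|jk] := posnP (j - k).
    by rewrite jk expr0 (size0nil (etrans sw jk)) big_nil.
  rewrite tailE INRE RdivE ?pnatr_eq0 -?lt0n // -sw.
  by apply: prod_le_avg => a /w_gt0/ltW.
have w0 : 0 < \prod_(a <- w) a by rewrite big_seq prodr_gt0.
have [|g gE] := @ext_sum_ln_pos (flatten_tail j k y).
  move=> a; rewrite mem_cat => /orP[ak|]; first by rewrite take_gt0 // takeE mem_cat ak.
  rewrite mem_nseq => /andP[jk /eqP ->]; rewrite lt_neqAle eq_sym.
  apply/andP; split.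
    (* A zero average would bound the positive product over [w] by 0. *)
    apply/negP => /eqP avg0; move: prod_w; rewrite avg0 expr0n gtn_eqF //.
    by rewrite leNgt w0.
  rewrite tailE INRE RdivE ?pnatr_eq0 -?lt0n // divr_ge0 // big_seq sumr_ge0 //.
  by move=> b /w_gt0/ltW.
exists g => //; have [_ ->] := ext_sum_ln_SomeP gE.
rewrite eE takeE !big_cat big_nseq iter_mulr_1 /=.
apply: ler_wpM2l prod_w; rewrite big_seq prodr_ge0 // => a ak.
by rewrite ltW // take_gt0 // takeE mem_cat ak.
Qed.

(** * The convex relaxation *)

Lemma XmatE d n (V : 'M[R]_(d, n)) c :
  Xmat V c = V *m diag_mx (\row_i c i) *m V^T.
Proof.
apply/matrixP => u v; rewrite mul_mx_diag summxE mxE; apply: eq_bigr => i _.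
by rewrite !mxE big_ord1 !mxE mulrCA mulrA.
Qed.

Lemma Xmat_sym d n (V : 'M[R]_(d, n)) c : (Xmat V c)^T = Xmat V c.
Proof. by rewrite XmatE !trmx_mul trmxK tr_diag_mx mulmxA. Qed.

Lemma Xmat_psd d n (V : 'M[R]_(d, n)) c : (forall i, 0 <= c i) ->
  forall x : 'cV_d, 0 <= (x^T *m Xmat V c *m x) 0 0.
Proof.
move=> c0 x; rewrite XmatE.
have -> : x^T *m (V *m diag_mx (\row_i c i) *m V^T) *m x =
    ((V^T *m x)^T *m diag_mx (\row_i c i)) *m (V^T *m x).
  by rewrite trmx_mul trmxK !mulmxA.
rewrite mul_mx_diag mxE sumr_ge0 // => i _.
by rewrite !mxE mulrAC mulr_ge0 ?c0 // -expr2 sqr_ge0.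
Qed.

(** Moving V cyclically turns V D V^T into D V^T V, and D only scales rows. *)
Lemma minor_sum_Xmat j d n (V : 'M[R]_(d, n)) c :
  minor_sum j (Xmat V c) =
  \sum_(s : {ffun 'I_j -> 'I_n}) (\prod_t c (s t)) * \det (mxsub s s (V^T *m V)).
Proof.
rewrite XmatE -mulmxA minor_sum_mulmxC -mulmxA.
apply: eq_bigr => s _; rewrite det_mxsub_mul_diag; congr (_ * _).
by apply: eq_bigr => t _; rewrite mxE.
Qed.

(** The list is an [epsilon] choice: the spectral theorem provides a witness, and unique
    factorization of the characteristic polynomial makes the choice a permutation of it. *)
Lemma eigenvalues_spec d (X : 'M[R]_d) :
  X^T = X -> (forall x : 'cV_d, 0 <= (x^T *m X *m x) 0 0) ->
  [/\ {in eigenvalues X, forall a, 0 <= a}, size (eigenvalues X) = d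
    & forall j, minor_sum j X = j`!%:R * esym j (eigenvalues X)].
Proof.
move=> symX posX; have [l [l0 charX sumX]] := sym_psd_spectrum symX posX.
pose s := [seq l 0 i | i <- enum 'I_d].
have Xs : is_eigenvalue_list X s.
  by rewrite /is_eigenvalue_list big_map big_enum.
have Xe : is_eigenvalue_list X (eigenvalues X).
  exact: epsilon_spec (ex_intro _ s Xs).
have pe : perm_eq (eigenvalues X) s by apply: prod_XsubC_eq; rewrite -Xe -Xs.
split.
- by move=> a; rewrite (perm_mem pe) => /mapP[i _ ->].
- by rewrite (perm_size pe) size_map size_enum_ord.
- move=> j; rewrite sumX minor_sum_diag (perm_esym _ pe).
  exact: (@esym_sum_inj _ j d (fun i => l 0 i)).
Qed.

Lemma expected_detE j d n (V : 'M[R]_(d, n)) c : (0 < j)%N ->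
  expected_det j (V^T *m V) c = j%:R ^- j * minor_sum j (Xmat V c).
Proof.
move=> j0; rewrite minor_sum_Xmat mulr_sumr; apply: eq_bigr => s _.
rewrite mulrA; congr (_ * _).
rewrite (eq_bigr (fun t => c (s t) * j%:R^-1)); last first.
  by move=> t _; rewrite INRE RdivE // pnatr_eq0 -lt0n.
by rewrite big_split /= prodr_const card_ord mulrC exprVn.
Qed.

(* For injective s this is the indicator vector of the image of s. *)
Definition multiplicity j n (s : 'I_j -> 'I_n) (i : 'I_n) : R :=
  \sum_t (s t == i)%:R.

Lemma feasible_multiplicity j n (s : 'I_j -> 'I_n) : feasible j (multiplicity s).
Proof.
split; last by move=> i; apply/RleP/sumr_ge0 => t _; exact: ler0n.
rewrite exchange_big /= (eq_bigr (fun=> 1)) ?sumr_const ?card_ord ?INRE //.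
by move=> t _; rewrite (bigD1 (s t)) //= eqxx big1 ?addr0 // => i;
  rewrite eq_sym => /negbTE ->.
Qed.

Lemma Xmat_multiplicity j d n (V : 'M[R]_(d, n)) (s : 'I_j -> 'I_n) :
  Xmat V (multiplicity s) = colsub s V *m (colsub s V)^T.
Proof.
apply/matrixP => u v; rewrite summxE mxE.
transitivity (\sum_i \sum_t (s t == i)%:R * (V u i * V v i)).
  by apply: eq_bigr => i _; rewrite !mxE big_ord1 !mxE mulr_suml.
rewrite exchange_big; apply: eq_bigr => t _; rewrite !mxE.
rewrite (bigD1 (s t)) //= eqxx mul1r big1 ?addr0 // => i.
by rewrite eq_sym => /negbTE ->; rewrite mul0r.
Qed.

(** With W = [colsub s V], the matrices W W^T and W^T W share their minor sums; the latter is j by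
    j, so order j gives its determinant and order j + 1 gives 0. *)
Lemma esym_eigenvalues_multiplicity j d n (V : 'M[R]_(d, n)) (s : 'I_j -> 'I_n) :
  let e := eigenvalues (Xmat V (multiplicity s)) in
  esym j e = \det (mxsub s s (V^T *m V)) /\ esym j.+1 e = 0.
Proof.
have [_ c0] := feasible_multiplicity s.
have [_ _ eE] := eigenvalues_spec (Xmat_sym V (multiplicity s))
  (Xmat_psd V (fun i => introT (RleP _ _) (c0 i))).
have fact_neq0 k : k`!%:R != 0 :> R by rewrite pnatr_eq0 -lt0n fact_gt0.
have sumE k : minor_sum k (Xmat V (multiplicity s)) =
    minor_sum k (mxsub s s (V^T *m V)).
  rewrite Xmat_multiplicity minor_sum_mulmxC; congr minor_sum.
  by apply/matrixP => a b; rewrite !mxE; apply: eq_bigr => i _; rewrite !mxE.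
move=> e; split.
  by apply: (mulfI (fact_neq0 j)); rewrite -eE sumE minor_sum_size.
by apply: (mulfI (fact_neq0 j.+1)); rewrite mulr0 -eE sumE minor_sum_gt_size.
Qed.

Lemma det_le_esym_optimal j d n (V : 'M[R]_(d, n)) alpha c (s : 'I_j -> 'I_n) :
  (j <= d)%N -> alpha_optimal j V alpha c ->
  exp (- alpha) * \det (mxsub s s (V^T *m V)) <= esym j (eigenvalues (Xmat V c)).
Proof.
move=> jd [[_ c0] opt].
have [e0 se _] := eigenvalues_spec (Xmat_sym V c)
  (Xmat_psd V (fun i => introT (RleP _ _) (c0 i))).
have fs := feasible_multiplicity s.
have [e0' se' _] := eigenvalues_spec (Xmat_sym V (multiplicity s))
  (Xmat_psd V (fun i => introT (RleP _ _) (fs.2 i))).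
have [detE eS0] := esym_eigenvalues_multiplicity V s.
have exp0 x : 0 < exp x by apply/RltP/exp_pos.
(* Positivity of the determinant is what makes gamma finite at the comparison point; otherwise the
   bound is a sign comparison. *)
have [det_le0|det_gt0] := leP (\det (mxsub s s (V^T *m V))) 0.
  by apply: le_trans (esym_ge0 _ e0); rewrite pmulr_rle0.
have [||g' gE' le_g'] := @esym_le_exp_gamma j _ e0' _ eS0; rewrite ?se' ?detE //.
have := opt _ fs; rewrite /Gamma gE'.
(* A finite value at the comparison point rules out the value -oo at c. *)
case gE: (gamma _ _) => [g|] //= le_g.
have {gE} := exp_gamma_le_esym e0 _ gE; rewrite se => /(_ jd).
apply: le_trans; rewrite detE in le_g'.
apply: (@le_trans _ _ (exp (- alpha) * exp g')); first by rewrite ler_pM2l.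
rewrite -[_ * _]exp_plus; apply/RleP.
by case: le_g => [lt_g|<-]; [left; apply: exp_increasing|right];
   rewrite Rplus_comm.
Qed.

Lemma expected_det_ge j d n (V : 'M[R]_(d, n)) alpha c :
  (0 < j)%N -> (j <= d)%N -> alpha_optimal j V alpha c ->
  Rle (Rmult (Rmult (Rdiv (INR j`!) (pow (INR j) j)) (exp (- alpha)))
       (msd j (V^T *m V)))
    (expected_det j (V^T *m V) c).
Proof.
move=> j0 jd opt; have [[_ c0] _] := opt.
have [e0 _ eE] := eigenvalues_spec (Xmat_sym V c)
  (Xmat_psd V (fun i => introT (RleP _ _) (c0 i))).
have jj : (j%:R : R) ^+ j != 0 by rewrite expf_neq0 // pnatr_eq0 -lt0n.
rewrite expected_detE // eE RpowE !INRE RdivE //.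
apply/RleP.
rewrite -[X in X <= _]/(j`!%:R / j%:R ^+ j * exp (- alpha) * msd j (V^T *m V)).
rewrite -mulrA [X in _ <= X]mulrA [_ ^- _ * _]mulrC.
apply: ler_wpM2l; first by rewrite divr_ge0 // exprn_ge0.
rewrite mulrC -ler_pdivlMr; last by apply/RltP/exp_pos.
(* The default 0 of the maximum must satisfy the bound too, hence nonnegativity of [esym]. *)
rewrite /msd; elim/big_ind: _ => [|x y hx hy|s _].
- by rewrite divr_ge0 ?esym_ge0 //; apply/RleP/Rlt_le/exp_pos.
- by apply/RleP/Rmax_lub; apply/RleP.
- rewrite ler_pdivlMr; last exact/RltP/exp_pos.
  by rewrite [X in X <= _]mulrC; exact: (det_le_esym_optimal s jd opt).
Qed.

Unset Implicit Arguments.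
Local Open Scope R_scope.

Theorem theorem4p6 (n d j : nat) (M : 'M[R]_n) (V : 'M[R]_(d, n))
  (alpha : R) (c : 'I_n -> R) :
  psd M -> \rank M = d -> M = V^T *m V ->
  (1 <= j)%N -> (j <= d)%N ->
  0 <= alpha ->
  alpha_optimal j V alpha c ->
  INR j`! / INR j ^ j * exp (- alpha) * msd j M <= expected_det j M c
  /\ Un_cv (fun m : nat => (INR m`! / INR m ^ m)
                           / (sqrt (2 * PI * INR m) * exp (- INR m))) 1.
Proof.
move=> _ _ -> j_gt0 j_le_d _ c_opt; split; last exact: stirling.
exact: expected_det_ge.
Qed.
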